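(* Let $\mathcal{Q}$ be a small quantaloid. The free cocompletion functor $\mathcal{P}:\mathcal{Q}\text{-}\mathbf{Cat}\to\mathcal{Q}\text{-}\mathbf{CCat}$ factors as $\mathcal{P}=\mathcal{M}\circ\mathbf{Y}$, where $\mathbf{Y}:\mathcal{Q}\text{-}\mathbf{Cat}\to\mathcal{Q}\text{-}\mathbf{Info}$ sends $\mathbb{A}$ to the graph $(\mathsf{Y}_{\mathbb{A}})_{\natural}:\mathbb{A}\rightsquigarrow\mathcal{P}\mathbb{A}$ of the Yoneda embedding, and $\mathcal{M}:\mathcal{Q}\text{-}\mathbf{Info}\to\mathcal{Q}\text{-}\mathbf{CCat}$ sends $\phi:\mathbb{A}\rightsquigarrow\mathbb{B}$ to $\phi^{\downarrow}\circ\phi_{\uparrow}(\mathcal{P}\mathbb{A})$.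
   Context: A quantaloid $\mathcal{Q}$ is a category whose hom-sets are complete lattices and whose composition preserves arbitrary joins in each variable; it is small if its objects $\mathcal{Q}_0$ and arrows form sets. For $f:X\to Y$, $g:Y\to Z$, $h:X\to Z$ in a quantaloid, $h\swarrow f:Y\to Z$ is the largest arrow with $(h\swarrow f)\circ f\le h$, and $g\searrow h:X\to Y$ is the largest arrow with $g\circ(g\searrow h)\le h$. A $\mathcal{Q}$-category $\mathbb{A}$ is a set $\mathbb{A}_0$ with a type map $t:\mathbb{A}_0\to\mathcal{Q}_0$ and hom-arrows $\mathbb{A}(x,y)\in\mathcal{Q}(tx,ty)$ with $1_{tx}\le\mathbb{A}(x,x)$ and $\mathbb{A}(y,z)\circ\mathbb{A}(x,y)\le\mathbb{A}(x,z)$. A $\mathcal{Q}$-functor $F:\mathbb{A}\to\mathbb{B}$ is a type-preserving map with $\mathbb{A}(x,x')\le\mathbb{B}(Fx,Fx')$. $\mathcal{Q}\text{-}\mathbf{Cat}$ is the category of $\mathcal{Q}$-categories and $\mathcal{Q}$-functors. The underlying preorder on $\mathbb{A}_0$ is: $x\le y$ iff $tx=ty$ and $1_{tx}\le\mathbb{A}(x,y)$; $\mathbb{A}$ is skeletal if this is antisymmetric; $\mathcal{Q}$-functors are ordered pointwise. $F:\mathbb{A}\to\mathbb{B}$ is left adjoint to $G:\mathbb{B}\to\mathbb{A}$ if $1_{\mathbb{A}}\le G\circ F$ and $F\circ G\le 1_{\mathbb{B}}$. A $\mathcal{Q}$-distributor $\phi:\mathbb{A}\rightsquigarrow\mathbb{B}$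 assigns to each $(x,y)\in\mathbb{A}_0\times\mathbb{B}_0$ an arrow $\phi(x,y)\in\mathcal{Q}(tx,ty)$ with $\mathbb{B}(y',y)\circ\phi(x,y')\le\phi(x,y)$ and $\phi(x',y)\circ\mathbb{A}(x,x')\le\phi(x,y)$. $\mathcal{Q}$-categories and $\mathcal{Q}$-distributors form a quantaloid with pointwise order, composition $(\psi\circ\phi)(x,z)=\bigvee_y\psi(y,z)\circ\phi(x,y)$, identities given by hom-arrows, and implications $(\eta\swarrow\phi)(y,z)=\bigwedge_x\eta(x,z)\swarrow\phi(x,y)$, $(\psi\searrow\eta)(x,y)=\bigwedge_z\psi(y,z)\searrow\eta(x,z)$. For $X\in\mathcal{Q}_0$, $*_X$ is the $\mathcal{Q}$-category with one object of type $X$ and hom-arrow $1_X$. $\mathcal{P}\mathbb{A}$ has as objects of type $X$ the distributors $\mu:\mathbb{A}\rightsquigarrow *_X$, with $\mathcal{P}\mathbb{A}(\mu,\lambda)=\lambda\swarrow\mu$. $\mathcal{P}^{\dagger}\mathbb{A}$ has as objects of type $X$ the distributors $\mu:*_X\rightsquigarrow\mathbb{A}$, with $\mathcal{P}^{\dagger}\mathbb{A}(\mu,\lambda)=\lambda\searrow\mu$. The Yoneda embedding $\mathsf{Y}_{\mathbb{A}}:\mathbb{A}\to\mathcal{P}\mathbb{A}$ is $\mathsf{Y}_{\mathbb{A}}a=\mathbb{A}(-,a)$. $\mathbb{A}$ is complete if for every $\mu\in\mathcal{P}\mathbb{A}$ there is an object $a$ with $\mathbb{A}(a,-)=\mathbb{A}\swarrow\mu$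 (equivalently, $\mathbb{A}$ has all weighted limits). $\mathcal{Q}\text{-}\mathbf{CCat}$ is the category of skeletal complete $\mathcal{Q}$-categories and left adjoint $\mathcal{Q}$-functors. For a $\mathcal{Q}$-functor $F:\mathbb{A}\to\mathbb{B}$: $F_{\natural}:\mathbb{A}\rightsquigarrow\mathbb{B}$, $F_{\natural}(x,y)=\mathbb{B}(Fx,y)$; $F^{\natural}:\mathbb{B}\rightsquigarrow\mathbb{A}$, $F^{\natural}(y,x)=\mathbb{B}(y,Fx)$; $F^{\rightarrow}:\mathcal{P}\mathbb{A}\to\mathcal{P}\mathbb{B}$, $F^{\rightarrow}(\mu)=\mu\circ F^{\natural}$; $F^{\leftarrow}:\mathcal{P}\mathbb{B}\to\mathcal{P}\mathbb{A}$, $F^{\leftarrow}(\lambda)=\lambda\circ F_{\natural}$. $\mathcal{P}$ sends $\mathbb{A}$ to $\mathcal{P}\mathbb{A}$ and $F$ to $F^{\rightarrow}$. $\mathcal{Q}\text{-}\mathbf{Info}$: objects are $\mathcal{Q}$-distributors; a morphism (infomorphism) $(F,G)$ from $\phi:\mathbb{A}\rightsquigarrow\mathbb{B}$ to $\psi:\mathbb{A}'\rightsquigarrow\mathbb{B}'$ is a pair of $\mathcal{Q}$-functors $F:\mathbb{A}\to\mathbb{A}'$, $G:\mathbb{B}'\to\mathbb{B}$ with $\phi(x,Gy')=\psi(Fx,y')$ for all $x,y'$. $\mathbf{Y}$ sends a $\mathcal{Q}$-functor $F:\mathbb{A}\to\mathbb{B}$ to the infomorphism $(F,F^{\leftarrow}):(\mathsf{Y}_{\mathbb{A}})_{\natural}\to(\mathsf{Y}_{\mathbb{B}})_{\natural}$.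 For $\phi:\mathbb{A}\rightsquigarrow\mathbb{B}$: $\phi_{\uparrow}:\mathcal{P}\mathbb{A}\to\mathcal{P}^{\dagger}\mathbb{B}$, $\phi_{\uparrow}(\mu)=\phi\swarrow\mu$, and $\phi^{\downarrow}:\mathcal{P}^{\dagger}\mathbb{B}\to\mathcal{P}\mathbb{A}$, $\phi^{\downarrow}(\lambda)=\lambda\searrow\phi$. $\phi^{\downarrow}\circ\phi_{\uparrow}(\mathcal{P}\mathbb{A})$ is the full $\mathcal{Q}$-subcategory of $\mathcal{P}\mathbb{A}$ of fixed points of the idempotent $\phi^{\downarrow}\circ\phi_{\uparrow}$. $\mathcal{M}$ sends $\phi$ to it and an infomorphism $(F,G):\phi\to\psi$ to $\psi^{\downarrow}\circ\psi_{\uparrow}\circ F^{\rightarrow}:\mathcal{M}(\phi)\to\mathcal{M}(\psi)$. *)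

(* Defs.v *)
From Stdlib Require Import ssreflect ssrfun.
From Stdlib Require Import FunctionalExtensionality PropExtensionality ProofIrrelevance.

Set Implicit Arguments.
Unset Strict Implicit.
Unset Printing Implicit Defensive.
#[local] Obligation Tactic := idtac.

Declare Scope quantaloid_scope.
Delimit Scope quantaloid_scope with Q.
Local Open Scope quantaloid_scope.

(* A set is a subset of an ambient type.  Thus a full subcategory keeps the
   ambient types of the category it lives in, and the full subcategory on all
   objects is equal, rather than merely isomorphic, to the whole category. *)
Record set := Set_ { ambient : Type; mem : ambient -> Prop }.

Definition elt (S : set) : Type := {x : ambient S | mem x}.
Coercion elt : set >-> Sortclass.

Definition total (T : Type) : set := {| ambient := T; mem := fun _ => True |}.
Definition mk T (x : T) : total T := exist _ x I.
Definition pr (S : set) (x : S) : ambient S := proj1_sig x.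

Lemma mkK T (x : total T) : mk (pr x) = x.
Proof. by case: x => x []. Qed.

Lemma elt_eq (S : set) (x y : S) : pr x = pr y -> x = y.
Proof.
case: x y => [x hx] [y hy] /= e; case: _ / e hy => hy.
by rewrite (proof_irrelevance _ hx hy).
Qed.

(* Smallness is a universe matter: the types of objects and of arrows are
   among those over which the sets of objects of Q-categories range. *)
Record quantaloid := Quantaloid {
  qob :> Type;
  qhom : qob -> qob -> Type;
  qle : forall {X Y}, qhom X Y -> qhom X Y -> Prop;
  qsup : forall {X Y}, (qhom X Y -> Prop) -> qhom X Y;
  qid : forall X, qhom X X;
  qcomp : forall {X Y Z}, qhom Y Z -> qhom X Y -> qhom X Z;
  qle_refl : forall X Y (f : qhom X Y), qle f f;
  qle_trans : forall X Y (f g h : qhom X Y), qle f g -> qle g h -> qle f h;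
  qle_antisym : forall X Y (f g : qhom X Y), qle f g -> qle g f -> f = g;
  qsup_ub : forall X Y (S : qhom X Y -> Prop) f, S f -> qle f (qsup S);
  qsup_lub : forall X Y (S : qhom X Y -> Prop) g,
    (forall f, S f -> qle f g) -> qle (qsup S) g;
  qcompA : forall W X Y Z (h : qhom Y Z) (g : qhom X Y) (f : qhom W X),
    qcomp h (qcomp g f) = qcomp (qcomp h g) f;
  qcomp1l : forall X Y (f : qhom X Y), qcomp (qid Y) f = f;
  qcomp1r : forall X Y (f : qhom X Y), qcomp f (qid X) = f;
  qcomp_supr : forall X Y Z (g : qhom Y Z) (S : qhom X Y -> Prop),
    qcomp g (qsup S) = qsup (fun h => exists f, S f /\ h = qcomp g f);
  qcomp_supl : forall X Y Z (S : qhom Y Z -> Prop) (f : qhom X Y),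
    qcomp (qsup S) f = qsup (fun h => exists g, S g /\ h = qcomp g f)
}.
Arguments qhom {q}.
Arguments qid {q} X.

Notation "f ≤ g" := (qle f g) (at level 70, no associativity) : quantaloid_scope.
Notation "g ∘ f" := (qcomp g f) (at level 40, left associativity) : quantaloid_scope.

Section QuantaloidTheory.
Variable Q : quantaloid.
Implicit Types X Y Z : Q.

Definition qinf X Y (S : qhom X Y -> Prop) : qhom X Y :=
  qsup (fun g => forall f, S f -> g ≤ f).

Definition lres X Y Z (h : qhom X Z) (f : qhom X Y) : qhom Y Z :=
  qsup (fun g => g ∘ f ≤ h).

Definition rres X Y Z (g : qhom Y Z) (h : qhom X Z) : qhom X Y :=
  qsup (fun f => g ∘ f ≤ h).

Lemma qsupP X Y (S : qhom X Y -> Prop) g :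
  qsup S ≤ g <-> (forall f, S f -> f ≤ g).
Proof.
split; last exact: qsup_lub.
by move=> h f Sf; apply: qle_trans h; apply: qsup_ub.
Qed.

Lemma qinfP X Y (S : qhom X Y -> Prop) g :
  g ≤ qinf S <-> (forall f, S f -> g ≤ f).
Proof.
split=> [h f Sf|h]; last exact: qsup_ub.
by apply: (qle_trans h); apply: qsup_lub => k; apply.
Qed.

Lemma comp_supP X Y Z (g : qhom Y Z) (S : qhom X Y -> Prop) h :
  g ∘ qsup S ≤ h <-> (forall f, S f -> g ∘ f ≤ h).
Proof.
rewrite qcomp_supr qsupP; split=> [H f Sf|H k [f [Sf ->]]]; last exact: H.
by apply: H; exists f.
Qed.

Lemma sup_compP X Y Z (S : qhom Y Z -> Prop) (f : qhom X Y) h :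
  qsup S ∘ f ≤ h <-> (forall g, S g -> g ∘ f ≤ h).
Proof.
rewrite qcomp_supl qsupP; split=> [H g Sg|H k [g [Sg ->]]]; last exact: H.
by apply: H; exists g.
Qed.

Lemma comp_monor X Y Z (g : qhom Y Z) (f f' : qhom X Y) :
  f ≤ f' -> g ∘ f ≤ g ∘ f'.
Proof.
move=> h; have -> : f' = qsup (fun k => k ≤ f').
  apply: qle_antisym; first by apply: qsup_ub; apply: qle_refl.
  by apply/qsupP.
by have /comp_supP := qle_refl (g ∘ qsup (fun k => k ≤ f')); apply.
Qed.

Lemma comp_monol X Y Z (g g' : qhom Y Z) (f : qhom X Y) :
  g ≤ g' -> g ∘ f ≤ g' ∘ f.
Proof.
move=> h; have -> : g' = qsup (fun k => k ≤ g').
  apply: qle_antisym; first by apply: qsup_ub; apply: qle_refl.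
  by apply/qsupP.
by have /sup_compP := qle_refl (qsup (fun k => k ≤ g') ∘ f); apply.
Qed.

Lemma lresP X Y Z (h : qhom X Z) (f : qhom X Y) g : g ≤ lres h f <-> g ∘ f ≤ h.
Proof.
split=> [H|H]; last exact: qsup_ub.
by apply: qle_trans (comp_monol f H) _; apply/sup_compP.
Qed.

Lemma rresP X Y Z (g : qhom Y Z) (h : qhom X Z) f : f ≤ rres g h <-> g ∘ f ≤ h.
Proof.
split=> [H|H]; last exact: qsup_ub.
by apply: qle_trans (comp_monor g H) _; apply/comp_supP.
Qed.

Lemma qle_ext X Y (f g : qhom X Y) : (forall h, h ≤ f <-> h ≤ g) -> f = g.
Proof. by move=> H; apply: qle_antisym; [rewrite -H|rewrite H]; apply: qle_refl. Qed.

Lemma qge_ext X Y (f g : qhom X Y) : (forall h, f ≤ h <-> g ≤ h) -> f = g.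
Proof. by move=> H; apply: qle_antisym; [rewrite H|rewrite -H]; apply: qle_refl. Qed.

End QuantaloidTheory.

Notation "h ↙ f" := (lres h f) (at level 50, no associativity) : quantaloid_scope.
Notation "g ↘ h" := (rres g h) (at level 50, no associativity) : quantaloid_scope.

(* The typed set of objects is given by its fibres: [A X] is the set of objects
   of type [X].  A type-preserving map is then a map of families. *)
Record qcat (Q : quantaloid) := QCat {
  cob :> Q -> set;
  hom : forall {X Y}, cob X -> cob Y -> qhom X Y;
  hom_id : forall X (x : cob X), qid X ≤ hom x x;
  hom_comp : forall X Y Z (x : cob X) (y : cob Y) (z : cob Z),
    hom y z ∘ hom x y ≤ hom x z
}.
Arguments hom {Q} q {X Y}.

Record qfunctor (Q : quantaloid) (A B : qcat Q) := QFunctor {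
  app : forall {X}, A X -> B X;
  app_hom : forall X Y (x : A X) (y : A Y), hom A x y ≤ hom B (app x) (app y)
}.
Arguments app {Q A B} q {X}.

Record dist (Q : quantaloid) (A B : qcat Q) := Dist {
  val : forall {X Y}, A X -> B Y -> qhom X Y;
  val_post : forall X Y Y' (x : A X) (y' : B Y') (y : B Y),
    hom B y' y ∘ val x y' ≤ val x y;
  val_pre : forall X X' Y (x : A X) (x' : A X') (y : B Y),
    val x' y ∘ hom A x x' ≤ val x y
}.
Arguments val {Q A B} d {X Y}.

Section QCategories.
Variable Q : quantaloid.
Implicit Types (X Y Z : Q) (A B C : qcat Q).

Lemma qfunctor_eq A B (F G : qfunctor A B) :
  (forall X (x : A X), app F x = app G x) -> F = G.
Proof.
case: F G => [f hf] [g hg] /= e.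
have {}e : f = g by do 2!(apply: functional_extensionality_dep => ?).
by case: _ / e hg => hg; rewrite (proof_irrelevance _ hf hg).
Qed.

Lemma dist_eq A B (phi psi : dist A B) :
  (forall X Y (x : A X) (y : B Y), val phi x y = val psi x y) -> phi = psi.
Proof.
case: phi psi => [f hf hf'] [g hg hg'] /= e.
have {}e : f = g by do 4!(apply: functional_extensionality_dep => ?).
case: _ / e hg hg' => hg hg'.
by rewrite (proof_irrelevance _ hf hg) (proof_irrelevance _ hf' hg').
Qed.

Definition ule A X (x y : A X) : Prop := qid X ≤ hom A x y.

Lemma ule_refl A X (x : A X) : ule x x.
Proof. exact: hom_id. Qed.

Definition skeletal A : Prop :=
  forall X (x y : A X), ule x y -> ule y x -> x = y.

Definition fid A : qfunctor A A :=
  {| app := fun _ x => x; app_hom := fun _ _ _ _ => qle_refl _ |}.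

Program Definition fcomp A B C (G : qfunctor B C) (F : qfunctor A B) :
  qfunctor A C := {| app := fun _ x => app G (app F x) |}.
Next Obligation.
move=> A B C G F X Y x y.
by apply: qle_trans (app_hom F x y) _; apply: app_hom.
Qed.

Lemma fcompE A B C (G : qfunctor B C) (F : qfunctor A B) X (x : A X) :
  app (fcomp G F) x = app G (app F x).
Proof. by []. Qed.

Definition fle A B (F G : qfunctor A B) : Prop :=
  forall X (x : A X), ule (app F x) (app G x).

Definition adjoint A B (F : qfunctor A B) (G : qfunctor B A) : Prop :=
  fle (fid A) (fcomp G F) /\ fle (fcomp F G) (fid B).

Definition left_adjoint A B (F : qfunctor A B) : Prop :=
  exists G : qfunctor B A, adjoint F G.

Program Definition dist_id A : dist A A := {| val := fun _ _ => hom A |}.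
Next Obligation. by move=> *; apply: hom_comp. Qed.
Next Obligation. by move=> *; apply: hom_comp. Qed.

Program Definition dist_comp A B C (psi : dist B C) (phi : dist A B) :
  dist A C :=
  {| val := fun X Z x z =>
       qsup (fun h => exists Y (y : B Y), h = val psi y z ∘ val phi x y) |}.
Next Obligation.
move=> A B C psi phi X Z Z' x z' z; apply/comp_supP => _ [Y [y ->]].
rewrite qcompA.
apply: qle_trans (comp_monol _ (val_post psi _ _ _)) _.
by apply: qsup_ub; exists Y, y.
Qed.
Next Obligation.
move=> A B C psi phi X X' Z x x' z; apply/sup_compP => _ [Y [y ->]].
rewrite -qcompA.
apply: qle_trans (comp_monor _ (val_pre phi _ _ _)) _.
by apply: qsup_ub; exists Y, y.
Qed.

Program Definition dist_lres A B C (eta : dist A C) (phi : dist A B) :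
  dist B C :=
  {| val := fun Y Z y z =>
       qinf (fun g => exists X (x : A X), g = val eta x z ↙ val phi x y) |}.
Next Obligation.
move=> A B C eta phi Y Z Z' y z' z; apply/qinfP => _ [X [x ->]].
apply/lresP; rewrite -qcompA; apply: qle_trans (val_post eta x z' z).
apply: comp_monor; apply/lresP.
by have /qinfP := qle_refl (qinf (fun g => exists X (x : A X),
  g = val eta x z' ↙ val phi x y)); apply; exists X, x.
Qed.
Next Obligation.
move=> A B C eta phi Y Y' Z y y' z; apply/qinfP => _ [X [x ->]].
apply/lresP; rewrite -qcompA.
apply: qle_trans (comp_monor _ (val_post phi x y y')) _; apply/lresP.
by have /qinfP := qle_refl (qinf (fun g => exists X (x : A X),
  g = val eta x z ↙ val phi x y')); apply; exists X, x.
Qed.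

Program Definition dist_rres A B C (psi : dist B C) (eta : dist A C) :
  dist A B :=
  {| val := fun X Y x y =>
       qinf (fun f => exists Z (z : C Z), f = val psi y z ↘ val eta x z) |}.
Next Obligation.
move=> A B C psi eta X Y Y' x y' y; apply/qinfP => _ [Z [z ->]].
apply/rresP; rewrite qcompA.
apply: qle_trans (comp_monol _ (val_pre psi y' y z)) _; apply/rresP.
by have /qinfP := qle_refl (qinf (fun g => exists Z (z : C Z),
  g = val psi y' z ↘ val eta x z)); apply; exists Z, z.
Qed.
Next Obligation.
move=> A B C psi eta X X' Y x x' y; apply/qinfP => _ [Z [z ->]].
apply/rresP; rewrite qcompA; apply: qle_trans (val_pre eta x x' z).
apply: comp_monol; apply/rresP.
by have /qinfP := qle_refl (qinf (fun g => exists Z (z : C Z),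
  g = val psi y z ↘ val eta x' z)); apply; exists Z, z.
Qed.

Lemma dist_compP A B C (psi : dist B C) (phi : dist A B) X Z
    (x : A X) (z : C Z) g :
  val (dist_comp psi phi) x z ≤ g <->
  (forall Y (y : B Y), val psi y z ∘ val phi x y ≤ g).
Proof.
rewrite /= qsupP; split=> [H Y y|H _ [Y [y ->]]]; last exact: H.
by apply: H; exists Y, y.
Qed.

Lemma dist_lresP A B C (eta : dist A C) (phi : dist A B) Y Z
    (y : B Y) (z : C Z) g :
  g ≤ val (dist_lres eta phi) y z <->
  (forall X (x : A X), g ∘ val phi x y ≤ val eta x z).
Proof.
rewrite /= qinfP; split=> [H X x|H _ [X [x ->]]]; last exact/lresP.
by apply/lresP; apply: H; exists X, x.
Qed.

Lemma dist_rresP A B C (psi : dist B C) (eta : dist A C) X Y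
    (x : A X) (y : B Y) f :
  f ≤ val (dist_rres psi eta) x y <->
  (forall Z (z : C Z), val psi y z ∘ f ≤ val eta x z).
Proof.
rewrite /= qinfP; split=> [H Z z|H _ [Z [z ->]]]; last exact/rresP.
by apply/rresP; apply: H; exists Z, z.
Qed.

Inductive point X : Q -> Type := Point : point X X.

Definition pt X : total (point X X) := mk (Point X).

Definition point_rect' X (P : Q -> Type) (p : P X) Y (s : total (point X Y)) : P Y :=
  match pr s in point _ Z return P Z with Point _ => p end.

Arguments point_rect' {X} P p {Y} s.

Lemma point_ind' X (P : forall Y, total (point X Y) -> Prop) :
  P X (pt X) -> forall Y s, P Y s.
Proof. by move=> p Y [[] []]. Qed.

Program Definition star X : qcat Q :=
  {| cob := fun Y => total (point X Y);
     hom := fun Y Z y z =>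
       point_rect' (fun Z => qhom Y Z) (point_rect' (fun Y => qhom Y X) (qid X) y) z |}.
Next Obligation.
by move=> X; apply: point_ind'; apply: qle_refl.
Qed.
Next Obligation.
move=> X; move=> W Y Z x y z; elim/point_ind': x; elim/point_ind': y.
by elim/point_ind': z; rewrite qcomp1l; apply: qle_refl.
Qed.

Definition pval A X (mu : total (dist A (star X))) Z (a : A Z) : qhom Z X :=
  val (pr mu) a (pt X).

Definition cval A X (mu : total (dist (star X) A)) Z (a : A Z) : qhom X Z :=
  val (pr mu) (pt X) a.

Program Definition PSh A : qcat Q :=
  {| cob := fun X => total (dist A (star X));
     hom := fun X Y mu lambda =>
       val (dist_lres (pr lambda) (pr mu)) (pt X) (pt Y) |}.
Next Obligation.
by move=> A X mu; apply/dist_lresP => Z z; rewrite qcomp1l; apply: qle_refl.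
Qed.
Next Obligation.
move=> A X Y Z mu nu lambda; apply/dist_lresP => W w; rewrite -qcompA.
have /dist_lresP/(_ W w) h1 := qle_refl (val (dist_lres (pr nu) (pr mu)) (pt X) (pt Y)).
have /dist_lresP/(_ W w) h2 := qle_refl (val (dist_lres (pr lambda) (pr nu)) (pt Y) (pt Z)).
by apply: qle_trans (comp_monor _ h1) h2.
Qed.

Program Definition coPSh A : qcat Q :=
  {| cob := fun X => total (dist (star X) A);
     hom := fun X Y mu lambda =>
       val (dist_rres (pr lambda) (pr mu)) (pt X) (pt Y) |}.
Next Obligation.
by move=> A X mu; apply/dist_rresP => Z z; rewrite qcomp1r; apply: qle_refl.
Qed.
Next Obligation.
move=> A X Y Z mu nu lambda; apply/dist_rresP => W w; rewrite qcompA.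
have /dist_rresP/(_ W w) h1 := qle_refl (val (dist_rres (pr nu) (pr mu)) (pt X) (pt Y)).
have /dist_rresP/(_ W w) h2 := qle_refl (val (dist_rres (pr lambda) (pr nu)) (pt Y) (pt Z)).
by apply: qle_trans (comp_monol _ h2) h1.
Qed.

Lemma PSh_homP A X Y (mu : PSh A X) (lambda : PSh A Y) u :
  u ≤ hom (PSh A) mu lambda <->
  (forall Z (a : A Z), u ∘ pval mu a ≤ pval lambda a).
Proof. exact: dist_lresP. Qed.

Lemma coPSh_homP A X Y (mu : coPSh A X) (lambda : coPSh A Y) u :
  u ≤ hom (coPSh A) mu lambda <->
  (forall Z (a : A Z), cval lambda a ∘ u ≤ cval mu a).
Proof. exact: dist_rresP. Qed.

Lemma PSh_hom_comp A X Y (mu : PSh A X) (lambda : PSh A Y) Z (a : A Z) :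
  hom (PSh A) mu lambda ∘ pval mu a ≤ pval lambda a.
Proof. by have /PSh_homP := qle_refl (hom (PSh A) mu lambda); apply. Qed.

Lemma coPSh_hom_comp A X Y (mu : coPSh A X) (lambda : coPSh A Y) Z (a : A Z) :
  cval lambda a ∘ hom (coPSh A) mu lambda ≤ cval mu a.
Proof. by have /coPSh_homP := qle_refl (hom (coPSh A) mu lambda); apply. Qed.

Lemma PSh_uleP A X (mu lambda : PSh A X) :
  ule mu lambda <-> (forall Z (a : A Z), pval mu a ≤ pval lambda a).
Proof.
rewrite /ule PSh_homP; split=> H Z a; first by rewrite -[pval mu a]qcomp1l.
by rewrite qcomp1l.
Qed.

Lemma PSh_eq A X (mu lambda : PSh A X) :
  (forall Z (a : A Z), pval mu a = pval lambda a) -> mu = lambda.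
Proof.
move=> H; apply: elt_eq; apply: dist_eq => Z Y a s.
by elim/point_ind': s; apply: H.
Qed.

Lemma PSh_skeletal A : skeletal (PSh A).
Proof.
move=> X mu lambda /PSh_uleP h1 /PSh_uleP h2.
by apply: PSh_eq => Z a; apply: qle_antisym.
Qed.

Program Definition rep A X (a : A X) : dist A (star X) :=
  {| val := fun Z Y z s => point_rect' (fun Y => qhom Z Y) (hom A z a) s |}.
Next Obligation.
move=> A X a Z Y Y' z s' s; elim/point_ind': s; elim/point_ind': s'.
by rewrite /= qcomp1l; apply: qle_refl.
Qed.
Next Obligation.
move=> A X a Z Z' Y z z' s; elim/point_ind': s; exact: hom_comp.
Qed.

Program Definition corep A X (a : A X) : dist (star X) A :=
  {| val := fun Y Z s z => point_rect' (fun Y => qhom Y Z) (hom A a z) s |}.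
Next Obligation.
move=> A X a Y Z Z' s z' z; elim/point_ind': s; exact: hom_comp.
Qed.
Next Obligation.
move=> A X a Y Y' Z s s' z; elim/point_ind': s; elim/point_ind': s'.
by rewrite /= qcomp1r; apply: qle_refl.
Qed.

Program Definition yoneda A : qfunctor A (PSh A) :=
  {| app := fun X a => mk (rep a) |}.
Next Obligation.
by move=> A X Y x y; apply/PSh_homP => Z a; apply: hom_comp.
Qed.

Lemma yoneda_hom A X Y (a : A X) (mu : PSh A Y) :
  hom (PSh A) (app (yoneda A) a) mu = pval mu a.
Proof.
apply: qle_ext => u; rewrite PSh_homP; split=> [H|H Z z].
  apply: qle_trans (H _ a); rewrite -{1}[u]qcomp1r.
  by apply: comp_monor; apply: hom_id.
apply: qle_trans (comp_monol _ H) _; exact: val_pre.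
Qed.

Definition complete A : Prop :=
  forall X (mu : PSh A X), exists a : A X,
    corep a = dist_lres (dist_id A) (pr mu).

Lemma completeP A :
  complete A <->
  (forall X (mu : PSh A X), exists a : A X, forall Y (y : A Y) u,
     u ≤ hom A a y <-> (forall Z (z : A Z), u ∘ pval mu z ≤ hom A z y)).
Proof.
split=> H X mu; have [a Ha] := H X mu; exists a.
  move=> Y y u; have -> : hom A a y = val (corep a) (pt X) y by [].
  by rewrite Ha dist_lresP.
apply: dist_eq => Z Y s y; elim/point_ind': s.
by apply: qle_ext => u; rewrite dist_lresP Ha.
Qed.

Program Definition graph A B (F : qfunctor A B) : dist A B :=
  {| val := fun X Y x y => hom B (app F x) y |}.
Next Obligation. by move=> *; apply: hom_comp. Qed.
Next Obligation.
move=> A B F X X' Y x x' y.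
by apply: qle_trans (comp_monor _ (app_hom F x x')) _; apply: hom_comp.
Qed.

Program Definition cograph A B (F : qfunctor A B) : dist B A :=
  {| val := fun Y X y x => hom B y (app F x) |}.
Next Obligation.
move=> A B F Y X X' y x' x.
by apply: qle_trans (comp_monol _ (app_hom F x' x)) _; apply: hom_comp.
Qed.
Next Obligation. by move=> *; apply: hom_comp. Qed.

Lemma pval_cographP A B (F : qfunctor A B) X (mu : PSh A X) Z (b : B Z) g :
  val (dist_comp (pr mu) (cograph F)) b (pt X) ≤ g <->
  (forall Y (a : A Y), pval mu a ∘ hom B b (app F a) ≤ g).
Proof. exact: dist_compP. Qed.

Program Definition direct A B (F : qfunctor A B) : qfunctor (PSh A) (PSh B) :=
  {| app := fun X mu => mk (dist_comp (pr mu) (cograph F)) |}.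
Next Obligation.
move=> A B F X Y mu lambda; apply/PSh_homP => Z b.
apply/comp_supP => _ [W [a ->]]; rewrite qcompA.
apply: qle_trans (comp_monol _ (PSh_hom_comp mu lambda a)) _.
by apply: qsup_ub; exists W, a.
Qed.

Program Definition inverse A B (F : qfunctor A B) : qfunctor (PSh B) (PSh A) :=
  {| app := fun X lambda => mk (dist_comp (pr lambda) (graph F)) |}.
Next Obligation.
move=> A B F X Y mu lambda; apply/PSh_homP => Z a.
apply/comp_supP => _ [W [b ->]]; rewrite qcompA.
apply: qle_trans (comp_monol _ (PSh_hom_comp mu lambda b)) _.
by apply: qsup_ub; exists W, b.
Qed.

Lemma inverseE A B (F : qfunctor A B) X (lambda : PSh B X) Z (a : A Z) :
  pval (app (inverse F) lambda) a = pval lambda (app F a).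
Proof.
apply: qle_antisym.
  by apply/qsupP => _ [W [b ->]]; apply: val_pre.
have h : pval lambda (app F a) ∘ hom B (app F a) (app F a) ≤
    pval (app (inverse F) lambda) a by apply: qsup_ub; exists Z, (app F a).
apply: qle_trans h; rewrite -{1}[pval lambda _]qcomp1r.
by apply: comp_monor; apply: hom_id.
Qed.

Lemma direct_ule A B (F : qfunctor A B) X (mu : PSh A X) (lambda : PSh B X) :
  ule (app (direct F) mu) lambda <->
  (forall Z (a : A Z), pval mu a ≤ pval lambda (app F a)).
Proof.
rewrite PSh_uleP; split=> H Z.
  move=> a; apply: qle_trans (H _ (app F a)); rewrite -{1}[pval mu a]qcomp1r.
  apply: qle_trans (comp_monor _ (hom_id (app F a))) _.
  by apply: qsup_ub; exists Z, a.
move=> b; apply/pval_cographP => Y a.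
apply: qle_trans (comp_monol _ (H Y a)) _; exact: val_pre.
Qed.

Lemma direct_adjoint A B (F : qfunctor A B) : adjoint (direct F) (inverse F).
Proof.
split=> X mu; rewrite fcompE.
  apply/PSh_uleP => Z a; rewrite inverseE.
  by move: Z a; apply/direct_ule; apply: ule_refl.
by apply/direct_ule => Z a; rewrite inverseE; apply: qle_refl.
Qed.

Lemma PSh_complete A : complete (PSh A).
Proof.
apply/completeP => X Phi; exists (app (inverse (yoneda A)) Phi) => Y lambda u.
rewrite PSh_homP; split=> [H Z mu|H Z a].
  apply/PSh_homP => W a; rewrite -(yoneda_hom a mu) -qcompA.
  apply: qle_trans (H W a); apply: comp_monor; rewrite inverseE.
  exact: val_pre.
by rewrite inverseE; apply: qle_trans (H _ _) _; rewrite yoneda_hom; apply: qle_refl.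
Qed.

Section Isbell.
Variables (A B : qcat Q) (phi : dist A B).

Program Definition isbell_up : qfunctor (PSh A) (coPSh B) :=
  {| app := fun X mu => mk (dist_lres phi (pr mu)) |}.
Next Obligation.
move=> X Y mu lambda; apply/coPSh_homP => Z b.
apply/dist_lresP => W a; rewrite -qcompA.
apply: qle_trans (comp_monor _ (PSh_hom_comp mu lambda a)) _.
have /dist_lresP := qle_refl (val (dist_lres phi (pr lambda)) (pt Y) b); apply.
Qed.

Program Definition isbell_down : qfunctor (coPSh B) (PSh A) :=
  {| app := fun X lambda => mk (dist_rres (pr lambda) phi) |}.
Next Obligation.
move=> X Y mu lambda; apply/PSh_homP => Z a.
apply/dist_rresP => W b; rewrite qcompA.
apply: qle_trans (comp_monol _ (coPSh_hom_comp mu lambda b)) _.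
have /dist_rresP := qle_refl (val (dist_rres (pr mu) phi) a (pt X)); apply.
Qed.

Definition isbell : qfunctor (PSh A) (PSh A) := fcomp isbell_down isbell_up.

Lemma upP X (mu : PSh A X) Z (b : B Z) u :
  u ≤ cval (app isbell_up mu) b <->
  (forall Y (a : A Y), u ∘ pval mu a ≤ val phi a b).
Proof. exact: dist_lresP. Qed.

Lemma downP X (lambda : coPSh B X) Z (a : A Z) u :
  u ≤ pval (app isbell_down lambda) a <->
  (forall Y (b : B Y), cval lambda b ∘ u ≤ val phi a b).
Proof. exact: dist_rresP. Qed.

Lemma isbell_ge X (mu : PSh A X) : ule mu (app isbell mu).
Proof.
apply/PSh_uleP => Z a; apply/downP => Y b.
by have /upP := qle_refl (cval (app isbell_up mu) b); apply.
Qed.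

Lemma isbell_mono X (mu nu : PSh A X) : ule mu nu -> ule (app isbell mu) (app isbell nu).
Proof. by move=> h; apply: qle_trans h (app_hom isbell mu nu). Qed.

Lemma down_fixed X (lambda : coPSh B X) :
  app isbell (app isbell_down lambda) = app isbell_down lambda.
Proof.
apply: PSh_skeletal; last exact: isbell_ge.
apply/PSh_uleP => Z a; apply/downP => Y b.
have /downP/(_ _ b) := qle_refl (pval (app isbell (app isbell_down lambda)) a).
apply: qle_trans; apply: comp_monol; apply/upP => W a'.
by have /downP := qle_refl (pval (app isbell_down lambda) a'); apply.
Qed.

Lemma isbell_homE X Y (mu : PSh A X) (nu : PSh A Y) :
  app isbell nu = nu -> hom (PSh A) (app isbell mu) nu = hom (PSh A) mu nu.
Proof.
move=> e; apply: qle_antisym; last by rewrite -{2}e; apply: app_hom.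
apply/PSh_homP => Z a; apply: qle_trans (PSh_hom_comp (app isbell mu) nu a).
by apply: comp_monor; move: Z a; apply/PSh_uleP; apply: isbell_ge.
Qed.

End Isbell.

Section FullSub.
Variables (A : qcat Q) (S : forall X, A X -> Prop).

Definition sub_set X : set :=
  {| ambient := ambient (A X);
     mem := fun x => exists h : mem x, S (exist _ x h) |}.

Lemma sub_mem X (x : sub_set X) : @mem (A X) (pr x).
Proof. by case: (proj2_sig x). Qed.

Definition sub_incl X (x : sub_set X) : A X := exist _ (pr x) (sub_mem x).

Lemma sub_inclP X (x : sub_set X) : S (sub_incl x).
Proof.
case: (proj2_sig x) => h; rewrite /sub_incl.
by rewrite (proof_irrelevance _ (sub_mem x) h).
Qed.

Definition sub_mk X (x : A X) (h : S x) : sub_set X.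
Proof.
exists (pr x); exists (proj2_sig x).
by case: x h.
Defined.

Lemma sub_mkK X (x : A X) (h : S x) : sub_incl (sub_mk h) = x.
Proof. exact: elt_eq. Qed.

Lemma sub_incl_inj X (x y : sub_set X) : sub_incl x = sub_incl y -> x = y.
Proof. by move=> e; apply: elt_eq; apply: (f_equal (fun z => pr z) e). Qed.

Definition full_sub : qcat Q :=
  {| cob := sub_set;
     hom := fun X Y x y => hom A (sub_incl x) (sub_incl y);
     hom_id := fun _ _ => hom_id _;
     hom_comp := fun _ _ _ _ _ _ => hom_comp _ _ _ |}.

Definition sub_fun : qfunctor full_sub A :=
  {| app := sub_incl : forall X, full_sub X -> A X;
     app_hom := fun _ _ _ _ => qle_refl _ |}.

End FullSub.

Definition concept A B (phi : dist A B) : qcat Q :=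
  full_sub (A := PSh A) (fun X mu => app (isbell phi) mu = mu).

Lemma concept_homE A B (phi : dist A B) X Y (mu : concept phi X)
    (nu : concept phi Y) :
  hom (concept phi) mu nu = hom (PSh A) (sub_incl mu) (sub_incl nu).
Proof. by []. Qed.

Lemma concept_fixed A B (phi : dist A B) X (mu : concept phi X) :
  app (isbell phi) (sub_incl mu) = sub_incl mu.
Proof. exact: (sub_inclP mu). Qed.

Lemma concept_skeletal A B (phi : dist A B) : skeletal (concept phi).
Proof. by move=> X mu nu h1 h2; apply: sub_incl_inj; apply: PSh_skeletal. Qed.

Lemma concept_complete A B (phi : dist A B) : complete (concept phi).
Proof.
apply/completeP => X Phi.
pose incl : qfunctor (concept phi) (PSh A) := sub_fun _.
have /completeP/(_ _ (app (direct incl) Phi)) [s Hs] := @PSh_complete A.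
have fix_s : app (isbell phi) (app (isbell phi) s) = app (isbell phi) s.
  exact: down_fixed.
exists (sub_mk fix_s) => Y lambda u.
rewrite concept_homE sub_mkK (isbell_homE _ (concept_fixed lambda)) Hs.
split=> H Z mu.
  apply: qle_trans (H Z (sub_incl mu)); apply: comp_monor.
  by move: Z mu; apply/(direct_ule incl); apply: ule_refl.
apply/comp_supP => _ [W [nu ->]]; rewrite qcompA.
apply: qle_trans (comp_monol _ (H W nu)) _.
exact: (hom_comp mu (sub_incl nu) (sub_incl lambda)).
Qed.

End QCategories.

Record infomorphism (Q : quantaloid) (A B A' B' : qcat Q)
    (phi : dist A B) (psi : dist A' B') := Infomorphism {
  info_fst : qfunctor A A';
  info_snd : qfunctor B' B;
  infoP : forall X Y (x : A X) (y' : B' Y),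
    val phi x (app info_snd y') = val psi (app info_fst x) y'
}.

Section Info.
Variable Q : quantaloid.
Implicit Types (A B C : qcat Q).

Lemma infomorphism_eq A B A' B' (phi : dist A B) (psi : dist A' B')
    (f g : infomorphism phi psi) :
  info_fst f = info_fst g -> info_snd f = info_snd g -> f = g.
Proof.
case: f g => [F G h] [F' G' h'] /= e e'.
case: _ / e h'; case: _ / e' => h'.
by rewrite (proof_irrelevance _ h h').
Qed.

Definition info_id A B (phi : dist A B) : infomorphism phi phi :=
  {| info_fst := fid A; info_snd := fid B; infoP := fun _ _ _ _ => erefl |}.

Program Definition info_comp A B A' B' A'' B'' (phi : dist A B)
    (psi : dist A' B') (chi : dist A'' B'')
    (g : infomorphism psi chi) (f : infomorphism phi psi) :
  infomorphism phi chi :=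
  {| info_fst := fcomp (info_fst g) (info_fst f);
     info_snd := fcomp (info_snd f) (info_snd g) |}.
Next Obligation.
by move=> A B A' B' A'' B'' phi psi chi g f X Y x y; rewrite /= !infoP.
Qed.

Program Definition yoneda_info A B (F : qfunctor A B) :
  infomorphism (graph (yoneda A)) (graph (yoneda B)) :=
  {| info_fst := F; info_snd := inverse F |}.
Next Obligation.
by move=> A B F X Y x mu; rewrite /val /graph !yoneda_hom inverseE.
Qed.

Program Definition concept_map A B A' B' (phi : dist A B) (psi : dist A' B')
    (f : infomorphism phi psi) : qfunctor (concept phi) (concept psi) :=
  {| app := fun X mu =>
       sub_mk (x := app (isbell psi) (app (direct (info_fst f)) (sub_incl mu))) _ |}.
Next Obligation. by move=> *; apply: down_fixed. Qed.
Next Obligation.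
move=> A B A' B' phi psi f X Y mu nu; rewrite !concept_homE !sub_mkK.
apply: qle_trans (app_hom (isbell psi) _ _).
exact: (app_hom (direct (info_fst f))).
Qed.

Section ConceptMap.
Variables (A B A' B' : qcat Q) (phi : dist A B) (psi : dist A' B').
Variable f : infomorphism phi psi.

Lemma concept_uleP X (mu nu : concept phi X) :
  ule mu nu <->
  (forall Z (a : A Z), pval (sub_incl mu) a ≤ pval (sub_incl nu) a).
Proof. exact: PSh_uleP. Qed.

Lemma concept_map_ule X (mu : concept phi X) (nu : concept psi X) :
  ule (app (concept_map f) mu) nu <->
  (forall Z (a : A Z),
     pval (sub_incl mu) a ≤ pval (sub_incl nu) (app (info_fst f) a)).
Proof.
rewrite -direct_ule {1}/ule concept_homE sub_mkK.
by rewrite (isbell_homE _ (concept_fixed nu)).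
Qed.

Lemma inverse_fixed X (nu : concept psi X) :
  app (isbell phi) (app (inverse (info_fst f)) (sub_incl nu)) =
  app (inverse (info_fst f)) (sub_incl nu).
Proof.
rewrite -(concept_fixed nu).
set l := app (isbell_up psi) (sub_incl nu).
have -> : app (isbell psi) (sub_incl nu) = app (isbell_down psi) l by [].
have fE Z (a : A Z) : pval (app (inverse (info_fst f)) (app (isbell_down psi) l)) a =
    pval (app (isbell_down psi) l) (app (info_fst f) a) by exact: inverseE.
apply: (PSh_skeletal _ (isbell_ge _ _)).
apply/PSh_uleP => Z a; rewrite fE; apply/downP => Y b.
rewrite -infoP.
have /downP/(_ _ (app (info_snd f) b)) := qle_refl (pval (app (isbell phi)
   (app (inverse (info_fst f)) (app (isbell_down psi) l))) a).
apply: qle_trans; apply: comp_monol; apply/upP => W a'.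
rewrite fE infoP.
by have /downP := qle_refl (pval (app (isbell_down psi) l) (app (info_fst f) a')); apply.
Qed.

Definition concept_inv X (nu : concept psi X) : concept phi X :=
  sub_mk (inverse_fixed nu).

Lemma concept_invE X (nu : concept psi X) Z (a : A Z) :
  pval (sub_incl (concept_inv nu)) a =
  pval (sub_incl nu) (app (info_fst f) a).
Proof. by rewrite sub_mkK inverseE. Qed.

Lemma concept_map_left_adjoint : left_adjoint (concept_map f).
Proof.
have h X Y (mu : concept psi X) (nu : concept psi Y) :
    hom (concept psi) mu nu ≤ hom (concept phi) (concept_inv mu) (concept_inv nu).
  rewrite !concept_homE !sub_mkK; exact: (app_hom (inverse (info_fst f))).
exists {| app := concept_inv; app_hom := h |}.
split=> X mu; last first.
  by apply/concept_map_ule => Z a; rewrite concept_invE; apply: qle_refl.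
apply/concept_uleP => Z a; rewrite concept_invE.
by move: Z a; apply/concept_map_ule; apply: ule_refl.
Qed.

End ConceptMap.

Lemma ule_ext A X (x y : A X) :
  skeletal A -> (forall z, ule x z <-> ule y z) -> x = y.
Proof. by move=> sk h; apply: sk; [rewrite h|rewrite -h]; apply: ule_refl. Qed.

Lemma concept_map_id A B (phi : dist A B) :
  concept_map (info_id phi) = fid (concept phi).
Proof.
apply: qfunctor_eq => X mu; apply: ule_ext => [|nu]; first exact: concept_skeletal.
by rewrite concept_map_ule concept_uleP.
Qed.

Lemma concept_map_comp A B A' B' A'' B'' (phi : dist A B)
    (psi : dist A' B') (chi : dist A'' B'')
    (g : infomorphism psi chi) (f : infomorphism phi psi) :
  concept_map (info_comp g f) = fcomp (concept_map g) (concept_map f).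
Proof.
apply: qfunctor_eq => X mu; apply: ule_ext => [|nu]; first exact: concept_skeletal.
rewrite fcompE !concept_map_ule.
have -> : (forall Z (b : A' Z), pval (sub_incl (app (concept_map f) mu)) b ≤
    pval (sub_incl nu) (app (info_fst g) b)) <->
    ule (app (concept_map f) mu) (concept_inv g nu).
  by rewrite concept_uleP; split=> H Z b; move: (H Z b); rewrite concept_invE.
by rewrite concept_map_ule; split=> H Z b; move: (H Z b); rewrite concept_invE.
Qed.

Lemma direct_id A : direct (fid A) = fid (PSh A).
Proof.
apply: qfunctor_eq => X mu; apply: ule_ext => [|nu]; first exact: PSh_skeletal.
by rewrite direct_ule PSh_uleP.
Qed.

Lemma direct_comp A B C (G : qfunctor B C) (F : qfunctor A B) :
  direct (fcomp G F) = fcomp (direct G) (direct F).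
Proof.
apply: qfunctor_eq => X mu; apply: ule_ext => [|nu]; first exact: PSh_skeletal.
rewrite fcompE !direct_ule.
split=> H.
  move=> Z b; rewrite -inverseE; move: Z b; apply/PSh_uleP/direct_ule => Z a.
  by rewrite inverseE; apply: H.
move=> Z a; have : ule (app (direct F) mu) (app (inverse G) nu).
  by apply/PSh_uleP => W b; rewrite inverseE; apply: H.
by move/direct_ule/(_ _ a); rewrite inverseE.
Qed.

Lemma inverse_id A : inverse (fid A) = fid (PSh A).
Proof. by apply: qfunctor_eq => X mu; apply: PSh_eq => Z a; rewrite inverseE. Qed.

Lemma inverse_comp A B C (G : qfunctor B C) (F : qfunctor A B) :
  inverse (fcomp G F) = fcomp (inverse F) (inverse G).
Proof.
by apply: qfunctor_eq => X mu; apply: PSh_eq => Z a; rewrite fcompE !inverseE.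
Qed.

End Info.

Record category := Category {
  obj :> Type;
  arr : obj -> obj -> Type;
  cid : forall x, arr x x;
  ccomp : forall {x y z}, arr y z -> arr x y -> arr x z;
  ccompA : forall w x y z (h : arr y z) (g : arr x y) (f : arr w x),
    ccomp h (ccomp g f) = ccomp (ccomp h g) f;
  ccomp1l : forall x y (f : arr x y), ccomp (cid y) f = f;
  ccomp1r : forall x y (f : arr x y), ccomp f (cid x) = f
}.
Arguments arr {c}.
Arguments cid {c} x.

Record functor (C D : category) := Functor {
  fobj :> C -> D;
  farr : forall {x y : C}, arr x y -> arr (fobj x) (fobj y);
  farr_id : forall x, farr (cid x) = cid (fobj x);
  farr_comp : forall x y z (g : arr y z) (f : arr x y),
    farr (ccomp g f) = ccomp (farr g) (farr f)
}.
Arguments farr {C D} F {x y} f : rename.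

Program Definition functor_comp (C D E : category)
    (G : functor D E) (F : functor C D) : functor C E :=
  {| fobj := fun x => G (F x); farr := fun x y f => farr G (farr F f) |}.
Next Obligation. by move=> C D E G F x; rewrite /= !farr_id. Qed.
Next Obligation. by move=> C D E G F x y z g f; rewrite /= !farr_comp. Qed.

Section Categories.
Variable Q : quantaloid.

Program Definition Cat : category :=
  {| obj := qcat Q; arr := @qfunctor Q; cid := @fid Q; ccomp := @fcomp Q |}.
Next Obligation. by move=> *; apply: qfunctor_eq. Qed.
Next Obligation. by move=> *; apply: qfunctor_eq. Qed.
Next Obligation. by move=> *; apply: qfunctor_eq. Qed.

Record ccat := CCat_ob {
  ccat_cat :> qcat Q;
  ccat_skeletal : skeletal ccat_cat;
  ccat_complete : complete ccat_cat
}.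

Definition ccat_arr (A B : ccat) : Type := {F : qfunctor A B | left_adjoint F}.

Lemma ccat_arr_eq (A B : ccat) (F G : ccat_arr A B) :
  proj1_sig F = proj1_sig G -> F = G.
Proof.
case: F G => [F hF] [G hG] /= e; case: _ / e hG => hG.
by rewrite (proof_irrelevance _ hF hG).
Qed.

Lemma left_adjoint_id (A : qcat Q) : left_adjoint (fid A).
Proof. by exists (fid A); split=> X x; apply: ule_refl. Qed.

Lemma ule_trans (A : qcat Q) (X : Q) (x y z : A X) : ule x y -> ule y z -> ule x z.
Proof.
move=> h1 h2; apply: qle_trans (hom_comp x y z).
rewrite /ule -[qid X]qcomp1l.
by apply: qle_trans (comp_monor _ h1) _; apply: comp_monol.
Qed.

Lemma app_ule (A B : qcat Q) (F : qfunctor A B) (X : Q) (x y : A X) :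
  ule x y -> ule (app F x) (app F y).
Proof. by move=> h; apply: qle_trans h _; apply: app_hom. Qed.

Lemma left_adjoint_comp (A B C : qcat Q) (G : qfunctor B C) (F : qfunctor A B) :
  left_adjoint G -> left_adjoint F -> left_adjoint (fcomp G F).
Proof.
move=> [G' [uG cG]] [F' [uF cF]]; exists (fcomp F' G'); split=> X x.
  exact: (ule_trans (uF _ x) (app_ule F' (uG _ (app F x)))).
exact: (ule_trans (app_ule G (cF _ (app G' x))) (cG _ x)).
Qed.

Program Definition CCat : category :=
  {| obj := ccat; arr := ccat_arr;
     cid := fun A => exist _ (fid A) (left_adjoint_id A);
     ccomp := fun A B C G F =>
       exist _ (fcomp (proj1_sig G) (proj1_sig F))
         (left_adjoint_comp (proj2_sig G) (proj2_sig F)) |}.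
Next Obligation. by move=> *; apply: ccat_arr_eq; apply: qfunctor_eq. Qed.
Next Obligation. by move=> *; apply: ccat_arr_eq; apply: qfunctor_eq. Qed.
Next Obligation. by move=> *; apply: ccat_arr_eq; apply: qfunctor_eq. Qed.

Record info := Info_ob {
  info_dom : qcat Q;
  info_cod : qcat Q;
  info_dist :> dist info_dom info_cod
}.

Program Definition Info : category :=
  {| obj := info;
     arr := fun phi psi => infomorphism phi psi;
     cid := fun phi => info_id phi;
     ccomp := fun phi psi chi g f => info_comp g f |}.
Next Obligation. by move=> *; apply: infomorphism_eq; apply: qfunctor_eq. Qed.
Next Obligation. by move=> *; apply: infomorphism_eq; apply: qfunctor_eq. Qed.
Next Obligation. by move=> *; apply: infomorphism_eq; apply: qfunctor_eq. Qed.

Program Definition PFunctor : functor Cat CCat :=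
  {| fobj := fun A : qcat Q =>
       {| ccat_cat := PSh A;
          ccat_skeletal := @PSh_skeletal Q A;
          ccat_complete := @PSh_complete Q A |} : CCat;
     farr := fun A B F =>
       exist _ (direct F) (ex_intro _ (inverse F) (direct_adjoint F)) |}.
Next Obligation. by move=> A; apply: ccat_arr_eq; apply: direct_id. Qed.
Next Obligation. by move=> A B C G F; apply: ccat_arr_eq; apply: direct_comp. Qed.

Program Definition YFunctor : functor Cat Info :=
  {| fobj := fun A : qcat Q => {| info_dist := graph (yoneda A) |} : Info;
     farr := fun A B F => yoneda_info F |}.
Next Obligation. by move=> A; apply: infomorphism_eq => //; apply: inverse_id. Qed.
Next Obligation. by move=> A B C G F; apply: infomorphism_eq => //; apply: inverse_comp. Qed.

Program Definition MFunctor : functor Info CCat :=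
  {| fobj := fun phi : info =>
       {| ccat_cat := concept phi;
          ccat_skeletal := concept_skeletal (phi := phi);
          ccat_complete := concept_complete (phi := phi) |} : CCat;
     farr := fun phi psi f =>
       exist _ (concept_map f) (concept_map_left_adjoint f) |}.
Next Obligation. by move=> phi; apply: ccat_arr_eq; apply: concept_map_id. Qed.
Next Obligation. by move=> *; apply: ccat_arr_eq; apply: concept_map_comp. Qed.

End Categories.

(* Main.v *)
Require Import Defs.
From Stdlib Require Import ssreflect ssrfun.
From Stdlib Require Import FunctionalExtensionality PropExtensionality ProofIrrelevance.

Set Implicit Arguments.
Unset Strict Implicit.
Unset Printing Implicit Defensive.
Local Open Scope quantaloid_scope.

(** By the Yoneda lemma every presheaf is a fixed point of the closure operator
    induced by the graph of the Yoneda embedding, so the concepts of this graph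
    form the full subcategory of [PSh A] on all objects. This subcategory is
    equal to [PSh A] by extensionality, and the inclusion is the transport
    along that equality. *)

Lemma isbell_graph_yoneda (Q : quantaloid) (A : qcat Q) (X : Q) (mu : PSh A X) :
  app (isbell (graph (yoneda A))) mu = mu.
Proof.
have graphE Z (a : A Z) : val (graph (yoneda A)) a mu = pval mu a.
  exact: yoneda_hom.
apply: (PSh_skeletal _ (isbell_ge _ _)); apply/PSh_uleP => Z a.
(* It suffices to test the closure against the column [mu] of the graph: there [isbell_up] of [mu]
   lies above the identity. *)
have /downP/(_ _ mu) :=
  qle_refl (pval (app (isbell (graph (yoneda A))) mu) a).
rewrite graphE; apply: qle_trans; rewrite -{1}[pval _ a]qcomp1l.
apply: comp_monol; apply/upP => Y b.
by rewrite qcomp1l graphE; apply: qle_refl.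
Qed.

Definition set_cast (S T : set) (e : S = T) (x : S) : T :=
  match e in _ = U return elt U with erefl => x end.

Lemma set_of_mem_eq (S : set) (m : ambient S -> Prop) :
  m = @mem S ->
  {e : Set_ m = S | forall x : Set_ m, pr (set_cast e x) = pr x}.
Proof. by case: S m => T m' m /= ->; exists erefl. Qed.

Definition qcat_cast (Q : quantaloid) (A B : qcat Q) (e : A = B) : qfunctor A B :=
  match e in _ = C return qfunctor A C with erefl => fid A end.

(** Once the fibres are identified, [F] acts as the identity, so full faithfulness equates the homs.
    Recording the cast with the equality tells how its transport acts. *)
Lemma qcat_eq (Q : quantaloid) (A B : qcat Q) (F : qfunctor A B)
    (e : forall X, A X = B X) :
  (forall X (x : A X), app F x = set_cast (e X) x) ->
  (forall X Y (x : A X) (y : A Y), hom A x y = hom B (app F x) (app F y)) ->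
  {E : A = B | qcat_cast E = F}.
Proof.
case: A F e => a h hi hc; case: B => b h' hi' hc' F e /= He Hh.
have E : a = b by apply: functional_extensionality_dep.
subst b.
have FE X (x : a X) : app F x = x.
  (* [e X] is now a loop, so its cast is trivial. *)
  by rewrite He (proof_irrelevance _ (e X) erefl).
have E : h = h'.
  by do 4!(apply: functional_extensionality_dep => ?); rewrite Hh !FE.
subst h'.
rewrite (proof_irrelevance _ hi' hi) (proof_irrelevance _ hc' hc) in F He Hh FE *.
by exists erefl; apply: qfunctor_eq => X x; rewrite FE.
Qed.

Lemma full_sub_all (Q : quantaloid) (A : qcat Q) (S : forall X, A X -> Prop) :
  (forall X (x : A X), S X x) ->
  {e : full_sub S = A | qcat_cast e = sub_fun S}.
Proof.
move=> HS.
(* [sub_set] keeps the ambient type of [A X], so only the membership predicates are compared. *)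
have me X : @mem (sub_set S X) = @mem (A X).
  apply: functional_extensionality => x; apply: propositional_extensionality.
  by split=> [[]|h] //; exists h.
pose c X := set_of_mem_eq (S := A X) (me X).
apply: (qcat_eq (A := full_sub S) (e := fun X => proj1_sig (c X))) => // X x.
by apply: elt_eq; rewrite (proj2_sig (c X)).
Qed.

Definition arr_of_eq (C : category) (x y : C) (e : x = y) : arr x y :=
  match e in _ = z return arr x z with erefl => cid x end.

(** Naturality of [arr_of_eq] expresses agreement on arrows without transport between hom types; for
    equal object maps the unit laws reduce it to plain equality. *)
Lemma functor_eq (C D : category) (F G : functor C D)
    (e : forall x, F x = G x) :
  (forall x y (f : arr x y),
     ccomp (farr G f) (arr_of_eq (e x)) = ccomp (arr_of_eq (e y)) (farr F f)) ->
  F = G.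
Proof.
case: F G e => F f fi fc [G g gi gc] /= e H.
have E : F = G by apply: functional_extensionality_dep.
subst G.
have E : f = g.
  apply: functional_extensionality_dep => x.
  apply: functional_extensionality_dep => y.
  apply: functional_extensionality => k; move: (H x y k).
  rewrite (proof_irrelevance _ (e x) erefl) (proof_irrelevance _ (e y) erefl) /=.
  by rewrite ccomp1l ccomp1r.
subst g.
by rewrite (proof_irrelevance _ fi gi) (proof_irrelevance _ fc gc).
Qed.

(** Skeletality and completeness are propositions, so proof irrelevance lifts the equality. *)
Lemma ccat_eq (Q : quantaloid) (A B : CCat Q)
    (e : ccat_cat A = ccat_cat B) :
  {E : A = B | proj1_sig (arr_of_eq E) = qcat_cast e}.
Proof.
case: A B e => A sA cA [B sB cB] /= e; subst B.
rewrite (proof_irrelevance _ sB sA) (proof_irrelevance _ cB cA).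
by exists erefl.
Qed.

Theorem proposition5p2p5 (Q : quantaloid) :
  PFunctor Q = functor_comp (MFunctor Q) (YFunctor Q).
Proof.
(* The inclusions run from concepts to presheaves. *)
symmetry.
pose e A := full_sub_all (@isbell_graph_yoneda Q A).
pose E A := @ccat_eq Q (functor_comp (MFunctor Q) (YFunctor Q) A)
  (PFunctor Q A) (proj1_sig (e A)).
apply: (functor_eq (e := fun A => proj1_sig (E A))) => A B F.
apply: ccat_arr_eq; rewrite /= (proj2_sig (E A)) (proj2_sig (E B)).
rewrite (proj2_sig (e A)) (proj2_sig (e B)).
(* With inclusions in place of transports, the square says that the closure fixes [direct F] of a
   presheaf. *)
apply: qfunctor_eq => X mu; symmetry.
exact: etrans (sub_mkK _) (isbell_graph_yoneda _).
Qed.
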